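(* For even $b\ge4$: $K_0(3)=b^{b+3}+b^2+2b-4$, and $K_{2+2\lambda}(3)=b^{b+3}+1+2\lambda$ for $0\le\lambda\le b-3$. For odd $b\ge5$: $K_0(3)=b^2+2b-3$, and $K_{2+2\lambda}(3)=b^2+1+2\lambda$ for $0\le\lambda\le\frac{b-5}{2}$.
   Context: Fix a base $b\ge2$. For $v\in\mathbb{N}$, $s(v)$ is the sum of the base-$b$ digits of $v$, $f(v)=v+s(v)$, and $F(u)=|\{v\in\mathbb{N}: f(v)=u\}|$. For a residue class $i$ modulo $b-1$ (with $i$ even if $b$ is odd), $K_i(n)$ is the smallest $u\in\mathbb{N}$ with $F(u)=n$ and $u\equiv i\pmod{b-1}$. Subscripts are read modulo $b-1$. *)

(* Defs.v *)
From mathcomp Require Import all_boot.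

Set Implicit Arguments.
Unset Strict Implicit.
Unset Printing Implicit Defensive.

(* The base-b digit of v at position i is (v %/ b ^ i) %% b. For 2 <= b, the
   digits at positions i >= v vanish because v < b ^ v. *)
Definition digit_sum (b v : nat) : nat := \sum_(i < v) (v %/ b ^ i) %% b.

Definition f (b v : nat) : nat := v + digit_sum b v.

(* Every v with f b v = u satisfies v <= u, so it is enough to count over
   v in {0, ..., u}. *)
Definition F (b u : nat) : nat := #|[set v : 'I_u.+1 | f b v == u]|.

(* K_i(n) = u for base b. *)
Definition is_K (b i n u : nat) : Prop :=
  [/\ F b u = n,
      u = i %[mod b - 1] &
      forall w : nat, F b w = n -> w = i %[mod b - 1] -> u <= w].

(* Main.v *)
Require Import Defs.
From mathcomp Require Import all_boot.
From mathcomp Require Import zify.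

(** If v ranges over the numbers below b^k, then b^k-1-v has the complementary
    digits, so f(b^k-1-v) = b^k-1+k(b-1)-f(v).  Together with
    f(b^k+v) = b^k+1+f(v) this gives F(b^k+1+x) = F(x) + F(x') whenever
    x + x' + 2 = k(b-1).  For n >= 2 the least u with F(u) >= n has this form
    for some k: otherwise all its generators share a nonzero leading digit,
    which can be lowered.  So F(u) >= 3 forces F(y) >= 2 and F(z) >= 1 for some
    y + z = k(b-1) - 2, and the least y with F(y) >= 2 (b^2+1 for even b,
    at least b+1 for odd b) together with parity bounds k from below. *)

Lemma eqmod_lt_double d t w :
  t = w %[mod d] -> w < t < w + 2 * d -> t = w + d.
Proof.
move=> /eqP tw /andP[wt td]; move: tw; rewrite eqn_mod_dvd ?(ltnW wt) //.
case/dvdnP=> m tE; have d0 : 0 < d by lia.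
have : m * d < 2 * d by lia.
rewrite ltn_pmul2r //; case: m tE => [|[|m]] // tE _; lia.
Qed.

(** * Digit sums and digit complements *)

Section DigitSum.

Variable b : nat.
Hypothesis b_gt1 : 1 < b.

Let b_gt0 : 0 < b := ltnW b_gt1.

(** Positions from v on carry the digit 0. The free bound lets sums for v and [v %/ b] be
    compared. *)
Lemma digit_sum_widen v N : v <= N ->
  digit_sum b v = \sum_(i < N) (v %/ b ^ i) %% b.
Proof.
move=> leN; rewrite /digit_sum -(big_mkord xpredT (fun i => (v %/ b ^ i) %% b)).
rewrite -[RHS](big_mkord xpredT (fun i => (v %/ b ^ i) %% b)).
rewrite [RHS](@big_cat_nat _ _ _ v) //= [X in _ = _ + X]big_nat_cond.
rewrite [X in _ = _ + X]big1 ?addn0 // => i /andP[/andP[vi _] _].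
rewrite divn_small ?mod0n //.
by apply: leq_trans (ltn_expl v b_gt1) _; rewrite leq_exp2l.
Qed.

Lemma digit_sum_rec v : digit_sum b v = v %% b + digit_sum b (v %/ b).
Proof.
rewrite (@digit_sum_widen _ v.+1) // big_ord_recl expn0 divn1.
rewrite (@digit_sum_widen (v %/ b) v) ?leq_div //.
by congr (_ + _); apply: eq_bigr => i _; rewrite expnS divnMA.
Qed.

Lemma digit_sum_small v : v < b -> digit_sum b v = v.
Proof.
by move=> vb; rewrite digit_sum_rec modn_small // divn_small // /digit_sum big_ord0 addn0.
Qed.

Lemma digit_sum_lead k r : b ^ k + r < b ^ k.+1 ->
  digit_sum b (b ^ k + r) = (digit_sum b r).+1.
Proof.
elim: k r => [|k IH] r.
  by rewrite expn0 expn1 => h; rewrite !digit_sum_small //; lia.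
move=> h; rewrite digit_sum_rec [in RHS]digit_sum_rec.
rewrite expnS mulnC modnMDl divnMDl // IH ?addnS //.
rewrite -(@ltn_pmul2r b) // -expnSr; apply: leq_ltn_trans h.
by rewrite mulnDl -expnSr leq_add2l leq_divM.
Qed.

Lemma digit_sum_compl k r : r < b ^ k ->
  digit_sum b (b ^ k - r.+1) + digit_sum b r = k * (b - 1).
Proof.
elim: k r => [|k IH] r; first by rewrite expn0; case: r => // _; rewrite /digit_sum !big_ord0.
rewrite {1}(divn_eq r b) => h.
have db : r %% b < b by rewrite ltn_pmod.
have qb : r %/ b < b ^ k by move: h db; rewrite expnS; move: (b ^ k) => B; nia.
have E : b ^ k.+1 - r.+1 = (b ^ k - (r %/ b).+1) * b + (b - (r %% b).+1).
  by rewrite {1}(divn_eq r b) expnS; move: (b ^ k) (r %/ b) (r %% b) qb db => B q d; nia.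
have sd : b - (r %% b).+1 < b by lia.
rewrite digit_sum_rec [digit_sum b r]digit_sum_rec E modnMDl divnMDl // modn_small //.
by rewrite (divn_small sd) addn0 mulSn -(IH _ qb); lia.
Qed.

Lemma f_small v : v < b -> f b v = v.*2.
Proof. by move=> vb; rewrite /f digit_sum_small // addnn. Qed.

Lemma f_lead k r : b ^ k + r < b ^ k.+1 -> f b (b ^ k + r) = (b ^ k).+1 + f b r.
Proof. by move=> h; rewrite /f digit_sum_lead //; lia. Qed.

Lemma f_compl k r : r < b ^ k ->
  (f b (b ^ k - r.+1) + f b r).+1 = b ^ k + k * (b - 1).
Proof. by move=> h; rewrite -(digit_sum_compl _ _ h) /f; lia. Qed.

Lemma leq_f v : v <= f b v.
Proof. exact: leq_addr. Qed.

(** Keeps both parts x and x' of [F_split] below b^k. *)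
Lemma muln_pred_ltn_exp k : k * (b - 1) < b ^ k.
Proof.
elim: k => [|k IH] //.
have k0 : 0 < b ^ k by rewrite expn_gt0 b_gt0.
by rewrite expnS mulSn; move: (b ^ k) IH k0 => B; nia.
Qed.

(** * Counting generators, and the splitting identity *)

Lemma F_sum u : F b u = \sum_(0 <= v < u.+1) (f b v == u).
Proof.
rewrite /F cardsE -sum1_card big_mkcond /= big_mkord.
by apply: eq_bigr => v _; rewrite unfold_in -[eqn _ _]/(_ == _); case: (_ == _).
Qed.

Lemma sum_leq_F N u : \sum_(0 <= v < N) (f b v == u) <= F b u.
Proof.
rewrite F_sum; case: (leqP N u.+1) => h.
  by rewrite [leqRHS](@big_cat_nat _ _ _ N) //= leq_addr.
rewrite [leqLHS](@big_cat_nat _ _ _ u.+1) ?(ltnW h) //=.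
rewrite [X in _ + X <= _]big_nat_cond [X in _ + X]big1 ?addn0 // => v /andP[/andP[uv _] _].
by have := leq_f v; case: eqP => //; lia.
Qed.

Lemma F_sum_widen N u : (forall v, f b v = u -> v < N) ->
  F b u = \sum_(0 <= v < N) (f b v == u).
Proof.
move=> hN; apply/eqP; rewrite eqn_leq sum_leq_F andbT F_sum.
case: (leqP N u.+1) => h; last first.
  by rewrite [leqRHS](@big_cat_nat _ _ _ u.+1) ?(ltnW h) //= leq_addr.
rewrite [leqLHS](@big_cat_nat _ _ _ N) //=.
rewrite [X in _ + X <= _]big_nat_cond [X in _ + X]big1 ?addn0 // => v /andP[/andP[Nv _] _].
by case: eqP => // /hN; lia.
Qed.

Lemma F_split k x x' : x + x' + 2 = k * (b - 1) ->
  F b (b ^ k + 1 + x) = F b x + F b x'.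
Proof.
move=> E; have kb := muln_pred_ltn_exp k.
have gen_lt y : y < b ^ k -> forall v, f b v = y -> v < b ^ k.
  by move=> yk v fv; have := leq_f v; lia.
rewrite (@F_sum_widen (b ^ k + b ^ k)); last by move=> v fv; have := leq_f v; lia.
(* Generators from b^k on have the form b^k + r and correspond to those of x; the ones below b^k,
   reflected, to those of x'. *)
rewrite (@big_cat_nat _ _ _ (b ^ k)) ?leq_addr //= addnC; congr (_ + _).
  rewrite (@F_sum_widen (b ^ k)); last by apply: gen_lt; lia.
  rewrite -{1}[b ^ k]add0n big_addn addnK big_nat [RHS]big_nat.
  apply: eq_bigr => r /andP[_ rk]; rewrite addnC f_lead.
    by congr nat_of_bool; lia.
  by rewrite expnS; move: (b ^ k) rk => B; nia.
rewrite (@F_sum_widen (b ^ k)); last by apply: gen_lt; lia.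
rewrite big_nat_rev /= big_nat [RHS]big_nat.
apply: eq_bigr => r /andP[_ rk]; rewrite add0n; have := f_compl _ _ rk.
by move=> ?; congr nat_of_bool; lia.
Qed.

(** A generator of u < b is a single digit, which f doubles, so only u/2 can occur. *)
Lemma F_lt_base u : u < b -> F b u = ~~ odd u.
Proof.
move=> ub; rewrite (@F_sum_widen b); last by move=> v fv; have := leq_f v; lia.
have -> : \sum_(0 <= v < b) (f b v == u) = \sum_(0 <= v < b) (v.*2 == u).
  by rewrite big_nat [RHS]big_nat; apply: eq_bigr => v /andP[_ vb]; rewrite f_small.
case: (boolP (odd u)) => ou /=.
  by rewrite big1 // => v _; case: eqP => // <- in ou *; rewrite odd_double in ou.
rewrite (@big_cat_nat _ _ _ u./2) ?(@big_ltn _ _ _ u./2) //=; try lia.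
rewrite big_nat big1 => [|v vu]; last by case: eqP => //; lia.
rewrite [X in _ + (_ + X)]big_nat big1 => [|v vu]; last by case: eqP => //; lia.
by case: eqP => //; lia.
Qed.

(** * Reduction of a large count to two smaller ones *)

Lemma F_reduce n w : 1 < n -> n <= F b w ->
  exists k x x',
    [/\ x + x' + 2 = k * (b - 1), b ^ k + 1 + x <= w,
        n <= F b x + F b x', F b x < n & F b x' < n].
Proof.
move=> n1 hw.
have ex : exists u, n <= F b u by exists w.
case: (ex_minnP ex) => u hu umin.
have {}umin y : y < u -> F b y < n by case: (leqP n (F b y)) => // /umin; lia.
have [v0 fv0] : exists v, f b v == u.
  move: hu; rewrite F_sum big_mkord => hu.
  have : \sum_(v < u.+1) (f b v == u) != 0 by lia.
  by rewrite sum_nat_eq0 => /forallPn[v]; rewrite /= eqb0 negbK => h; exists v.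
have vle v : f b v == u -> v <= u by move=> /eqP <-; exact: leq_f.
case: (ex_maxnP (ex_intro _ v0 fv0) vle) => v /eqP fv vmax.
(* For v = 0 also u = 0, which has one generator, against n > 1. *)
have v0' : 0 < v.
  case: (posnP v) => // vz; move: fv hu; rewrite vz f_small // => <-.
  by rewrite F_lt_base //=; lia.
have /andP[kv vk] := trunc_log_bounds b_gt1 v0'.
move: (trunc_log b v) kv vk => k kv vk.
have k0 : 0 < b ^ k by rewrite expn_gt0 b_gt0.
have fk : f b v = (b ^ k).+1 + f b (v - b ^ k) by rewrite -f_lead subnKC.
have Fu : F b u = \sum_(0 <= i < b ^ k) (f b i == u) +
                  \sum_(b ^ k <= i < b ^ k.+1) (f b i == u).
  rewrite -big_cat_nat ?leq_exp2l //= -F_sum_widen // => i fi.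
  by apply: leq_ltn_trans vk; apply: vmax; apply/eqP.
(* All generators are at most v, hence below b^(k+1). If none is below b^k, subtracting b^k from
   each contradicts the minimality of u. *)
have [s0|] := posnP (\sum_(0 <= i < b ^ k) (f b i == u)).
  have /umin : u - (b ^ k).+1 < u by lia.
  rewrite ltnNge => /negP[].
  apply: leq_trans hu _; rewrite Fu s0 add0n.
  apply: leq_trans (sum_leq_F (b ^ k.+1 - b ^ k) _).
  rewrite -{1}[b ^ k]add0n big_addn big_nat [leqRHS]big_nat.
  apply: leq_sum => r /andP[_ rk]; rewrite addnC f_lead; last by lia.
  by case: eqP => //= h; case: eqP => //; lia.
rewrite lt0n big_mkord sum_nat_eq0 => /forallPn[[i ik]] /=.
rewrite eqb0 negbK => /eqP fi.
have := f_compl _ _ ik => cE.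
have kb := muln_pred_ltn_exp k.
(* Lower the leading digit of v and complement the small generator i; f(v) = f(i) = u gives the
   required sum. *)
exists k, (f b (v - b ^ k)), (f b (b ^ k - i.+1)).
have E : f b (v - b ^ k) + f b (b ^ k - i.+1) + 2 = k * (b - 1) by lia.
split=> //; [|rewrite -(F_split _ _ _ E)|apply: umin|apply: umin]; try lia.
  have := umin w; lia.
by have -> : b ^ k + 1 + f b (v - b ^ k) = u by lia.
Qed.

Lemma F_ge3_split w : 2 < F b w ->
  exists k y z, [/\ y + z + 2 = k * (b - 1), b ^ k + 1 <= w, 1 < F b y & 0 < F b z].
Proof.
move=> /(F_reduce 3 _ isT)[k [x [x' [E kw h hx hx']]]].
case: (ltnP 1 (F b x)) => Fx; [exists k, x, x' | exists k, x', x]; split; lia.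
Qed.

Lemma exp_mod_pred n : exists q, b ^ n = q * (b - 1) + 1.
Proof.
elim: n => [|n [q E]]; first by exists 0.
exists (q * b + 1); rewrite expnS E; nia.
Qed.

(** * Even base *)

Section EvenBase.

Hypotheses (b_even : ~~ odd b) (b_ge4 : 4 <= b).

(** The case k = 0 is void. For k = 1 the parts sum to the odd number b - 3, so one of them is odd
    and has no generator. *)
Lemma F_gt1_even y : 1 < F b y -> b ^ 2 + 1 <= y.
Proof.
move=> /(F_reduce 2 _ isT)[k [x [x' [E kw h hx hx']]]].
case: k E kw => [|[|k]] E kw; first lia.
  have := F_lt_base x; have := F_lt_base x'; lia.
have : b ^ 2 <= b ^ k.+2 by rewrite leq_exp2l.
lia.
Qed.

(** Split with k = 2: the second part is too small for two generators, so x = y - (b^2+1) < b has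
    one and is even. *)
Lemma F_gt1_even_odd y : 1 < F b y -> y < b ^ 2 + b -> odd y.
Proof.
move=> Fy yb; have yb' := F_gt1_even _ Fy.
have E : (y - (b ^ 2 + 1)) + (2 * b - 4 - (y - (b ^ 2 + 1))) + 2 = 2 * (b - 1) by lia.
have := F_split _ _ _ E; rewrite subnKC // => Fs.
have F1 : F b (2 * b - 4 - (y - (b ^ 2 + 1))) <= 1.
  by rewrite leqNgt; apply/negP => /F_gt1_even; nia.
have F2 : F b (y - (b ^ 2 + 1)) > 0 by lia.
rewrite F_lt_base in F2; last by lia.
have : ~~ odd (b ^ 2) by rewrite oddX.
lia.
Qed.

Lemma F_ge3_even w : 2 < F b w -> b ^ (b + 3) + 1 <= w.
Proof.
move=> /F_ge3_split[k [y [z [E kw Fy Fz]]]].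
have yb := F_gt1_even _ Fy.
have kb : b + 3 <= k.
  rewrite leqNgt; apply/negP => kb.
  (* As y + 2 > (b+1)(b-1), k is at least b + 2. *)
  have kE : k = b + 2 by nia.
  (* Now y + z = b^2+b-4 is even, while y is odd and z < b, having a
     generator, is even. *)
  have := F_gt1_even_odd _ Fy; have := F_lt_base z.
  have : ~~ odd (b * b) by rewrite oddM negb_and b_even.
  by nia.
have : b ^ (b + 3) <= b ^ k by rewrite leq_exp2l.
lia.
Qed.

(** Two generators would need b^2 + 1. For 2m > b the split with k = 1 has an odd part, without
    generator, and an even part with one. *)
Lemma F_double_even m : m <= b - 2 -> F b (2 * m) = 1.
Proof.
move=> mb; apply/eqP; rewrite eqn_leq; apply/andP; split.
  by rewrite leqNgt; apply/negP => /F_gt1_even; nia.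
case: (ltngtP (2 * m) b) => [h|h|h].
- by rewrite F_lt_base //; lia.
- have E : (2 * m - b.+1) + (2 * b - 2 - 2 * m) + 2 = 1 * (b - 1) by lia.
  have -> : 2 * m = b ^ 1 + 1 + (2 * m - b.+1) by rewrite expn1; lia.
  by rewrite (F_split _ _ _ E) !F_lt_base; lia.
- apply: leq_trans (sum_leq_F b.+1 _).
  rewrite (@big_cat_nat _ _ _ b./2) ?(@big_ltn _ _ _ b./2) //=; try lia.
  by rewrite f_small; lia.
Qed.

(* X = (b+3)(b-1) - 2, so x and X - x are paired by F_split with k = b+3. *)
Let X := b ^ 2 + 2 * b - 5.

Lemma X_lt_exp : X < b ^ (b + 3).
Proof.
have : b ^ 4 <= b ^ (b + 3) by rewrite leq_exp2l //; lia.
rewrite /X !expnS expn0; nia.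
Qed.

Lemma F_split_even x x' : x + x' = X -> F b (b ^ (b + 3) + 1 + x) = F b x + F b x'.
Proof. by move=> E; apply: F_split; rewrite E /X; nia. Qed.

(** The split with k = 2 pairs 2(b-3-l) with 2(l+1), each with exactly one generator. *)
Lemma F_even_compl l : l <= b - 3 -> F b (X - 2 * l) = 2.
Proof.
move=> lb.
have -> : X - 2 * l = b ^ 2 + 1 + 2 * (b - 3 - l) by rewrite /X; lia.
rewrite (@F_split 2 _ (2 * l.+1)); last by nia.
by rewrite !F_double_even; lia.
Qed.

Lemma F_lt_3_even x : x <= X -> F b x < 3.
Proof.
move=> xX; rewrite ltnNge; apply/negP => /F_ge3_even.
have := X_lt_exp; lia.
Qed.

Lemma is_K_even_0 : is_K b 0 3 (b ^ (b + 3) + b ^ 2 + 2 * b - 4).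
Proof.
have -> : b ^ (b + 3) + b ^ 2 + 2 * b - 4 = b ^ (b + 3) + 1 + X by rewrite /X; nia.
have [q Eq] := exp_mod_pred (b + 3).
have tE : b ^ (b + 3) + 1 + X = (q + b + 3) * (b - 1) by rewrite Eq /X; nia.
split.
- rewrite (@F_split_even _ 0) ?addn0 //.
  have := F_even_compl 0; rewrite muln0 subn0 => -> //.
  by rewrite F_lt_base //; lia.
- by rewrite tE modnMl mod0n.
- move=> w Fw; rewrite mod0n => wm; rewrite leqNgt; apply/negP => wt.
  have wb : b ^ (b + 3) + 1 <= w by apply: F_ge3_even; rewrite Fw.
  have [m wE] : exists m, w = m * (b - 1) by apply/dvdnP/eqP.
  pose x := w - (b ^ (b + 3) + 1).
  have xE : w = b ^ (b + 3) + 1 + x by rewrite /x; lia.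
  have xX : x < X by lia.
  have E : x + (X - x) = X by lia.
  have Fx := F_split_even _ _ E.
  rewrite -xE Fw in Fx.
  have x'E : X - x = (q + b + 3 - m) * (b - 1) by rewrite mulnBl -tE; lia.
  have Fx3 : F b x < 3 by apply: F_lt_3_even; lia.
  have Fx'3 : F b (X - x) < 3 by apply: F_lt_3_even; lia.
  (* The part with two generators is at least b^2 + 1. The residue of the other then forces X - x =
     b - 1 or x = b - 3, both odd and below b, hence without generators. *)
  have [Fx1|Fx1] : 1 < F b x \/ 1 < F b (X - x) by lia.
    have := F_gt1_even _ Fx1 => xb.
    have : (q + b + 3 - m) * (b - 1) < 2 * (b - 1) by rewrite -x'E /X; lia.
    rewrite ltn_pmul2r; last by lia.
    case: (q + b + 3 - m) x'E => [|[|j]] // x'E _; first by lia.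
    by have := F_lt_base (b - 1); rewrite mul1n in x'E; rewrite -x'E; lia.
  have := F_gt1_even _ Fx1 => xb.
  have x2 : x + 2 = (m - q) * (b - 1).
    by rewrite mulnBl -wE xE Eq /X; lia.
  have : (m - q) * (b - 1) < 2 * (b - 1) by rewrite -x2 /X in xb *; lia.
  rewrite ltn_pmul2r; last by lia.
  case: (m - q) x2 => [|[|j]] // x2 _; first by lia.
  by have := F_lt_base x; lia.
Qed.

Lemma is_K_even l : l <= b - 3 -> is_K b (2 + 2 * l) 3 (b ^ (b + 3) + 1 + 2 * l).
Proof.
move=> lb; have [q Eq] := exp_mod_pred (b + 3).
split.
- rewrite (@F_split_even _ (X - 2 * l)); last by rewrite /X; nia.
  by rewrite F_even_compl // F_double_even; lia.
- have -> : b ^ (b + 3) + 1 + 2 * l = q * (b - 1) + (2 + 2 * l) by lia.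
  by rewrite modnMDl.
- move=> w Fw wm; rewrite leqNgt; apply/negP => wt.
  have wb : b ^ (b + 3) + 1 <= w by apply: F_ge3_even; rewrite Fw.
  have tE : b ^ (b + 3) + 1 + 2 * l = w %[mod b - 1].
    by rewrite wm -[RHS](modnMDl q) Eq; congr (_ %% _); lia.
  have {tE wm Eq} wE := eqmod_lt_double _ _ _ tE.
  have {}wE : b ^ (b + 3) + 1 + 2 * l = w + (b - 1) by apply: wE; lia.
  pose x := w - (b ^ (b + 3) + 1).
  have xE : w = b ^ (b + 3) + 1 + x by rewrite /x; lia.
  have xX : x <= X by rewrite /X; nia.
  have E : x + (X - x) = X by lia.
  (* Here x = 2l - (b-1) is odd and below b, so all three generators would have to come from X -
     x. *)
  have := F_split_even _ _ E; rewrite -xE Fw F_lt_base; last by lia.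
  have := F_lt_3_even (X - x); lia.
Qed.

End EvenBase.

(** * Odd base *)

Section OddBase.

Hypotheses (b_odd : odd b) (b_ge5 : 5 <= b).

Lemma F_gt1_odd y : 1 < F b y -> b + 1 <= y.
Proof.
move=> /(F_reduce 2 _ isT)[k [x [x' [E kw h hx hx']]]].
case: k E kw => [|k] E kw; first lia.
have : b ^ 1 <= b ^ k.+1 by rewrite leq_exp2l.
by rewrite expn1; lia.
Qed.

(** From y >= b + 1 follows k(b-1) > b - 1, so k >= 2. *)
Lemma F_ge3_odd w : 2 < F b w -> b ^ 2 + 1 <= w.
Proof.
move=> /F_ge3_split[k [y [z [E kw Fy Fz]]]].
have yb := F_gt1_odd _ Fy.
have : b ^ 2 <= b ^ k by rewrite leq_exp2l //; nia.
lia.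
Qed.

(** For odd b both parts of the split with k = 1 are even and below b. *)
Lemma F_double_odd m : b < 2 * m <= 2 * b - 2 -> F b (2 * m) = 2.
Proof.
move=> h.
have E : (2 * m - b.+1) + (2 * b - 2 - 2 * m) + 2 = 1 * (b - 1) by lia.
have -> : 2 * m = b ^ 1 + 1 + (2 * m - b.+1) by rewrite expn1; lia.
by rewrite (F_split _ _ _ E) !F_lt_base; lia.
Qed.

Lemma is_K_odd_0 : is_K b 0 3 (b ^ 2 + 2 * b - 3).
Proof.
have tE : b ^ 2 + 2 * b - 3 = (b + 3) * (b - 1) by nia.
split.
- have -> : b ^ 2 + 2 * b - 3 = b ^ 2 + 1 + 2 * (b - 2) by lia.
  rewrite (@F_split 2 _ 0); last by lia.
  by rewrite F_double_odd ?F_lt_base //; lia.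
- by rewrite tE modnMl mod0n.
- move=> w Fw; rewrite mod0n => wm; rewrite leqNgt; apply/negP => wt.
  have wb : b ^ 2 + 1 <= w by apply: F_ge3_odd; rewrite Fw.
  have [m wE] : exists m, w = m * (b - 1) by apply/dvdnP/eqP.
  (* This is the only smaller multiple of b - 1 above b^2; its parts b - 3 and b - 1 give just two
     generators. *)
  have mE : m = b + 2 by nia.
  have {}wE : w = b ^ 2 + 1 + (b - 3) by rewrite wE mE; nia.
  have := @F_split 2 (b - 3) (b - 1); rewrite -wE Fw !F_lt_base; lia.
Qed.

Lemma is_K_odd l : l <= (b - 5) %/ 2 -> is_K b (2 + 2 * l) 3 (b ^ 2 + 1 + 2 * l).
Proof.
move=> lb; have {}lb : 2 * l <= b - 5 by lia.
split.
- rewrite (@F_split 2 _ (2 * (b - 2 - l))); last by lia.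
  by rewrite F_lt_base ?F_double_odd; lia.
- have -> : b ^ 2 + 1 + 2 * l = (b + 1) * (b - 1) + (2 + 2 * l) by nia.
  by rewrite modnMDl.
- move=> w Fw wm; rewrite leqNgt; apply/negP => wt.
  have wb : b ^ 2 + 1 <= w by apply: F_ge3_odd; rewrite Fw.
  have tE : b ^ 2 + 1 + 2 * l = w %[mod b - 1].
    by rewrite wm -[RHS](modnMDl (b + 1)); congr (_ %% _); nia.
  (* Since 2l <= b - 5 is less than the period b - 1, no smaller member of the class is at least b^2
     + 1. *)
  by have {tE wm} := eqmod_lt_double _ _ _ tE; lia.
Qed.

End OddBase.

End DigitSum.

Theorem theorem4p7 (b : nat) :
  (~~ odd b -> 4 <= b ->
     is_K b 0 3 (b ^ (b + 3) + b ^ 2 + 2 * b - 4) /\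
     (forall l : nat, l <= b - 3 ->
        is_K b (2 + 2 * l) 3 (b ^ (b + 3) + 1 + 2 * l))) /\
  (odd b -> 5 <= b ->
     is_K b 0 3 (b ^ 2 + 2 * b - 3) /\
     (forall l : nat, l <= (b - 5) %/ 2 ->
        is_K b (2 + 2 * l) 3 (b ^ 2 + 1 + 2 * l))).
Proof.
split=> pb lb; have b1 : 1 < b by lia.
  by split=> [|l]; [apply: is_K_even_0|apply: is_K_even].
by split=> [|l]; [apply: is_K_odd_0|apply: is_K_odd].
Qed.
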